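(* Let $G$ be a topological group and let $X$ be a $G$-flow. Suppose $X$ is a minimal $G$-flow. Then $S_G(X)$ is a minimal $G$-flow.
   Context: All groups and spaces are Hausdorff. For a topological group $G$, a $G$-flow is a compact space $X$ with a continuous action $G\times X\to X$. It is minimal if every orbit is dense. Let $\mathcal{N}_G$ be the collection of symmetric open neighborhoods of the identity in $G$, and $\mathrm{op}(X)$ the collection of nonempty open subsets of $X$. For $U\subseteq G$ and $A\subseteq X$, $UA=\{ga: g\in U, a\in A\}$. A near filter is a family $\mathcal{F}\subseteq \mathrm{op}(X)$ such that for any $A_1,\dots,A_k\in\mathcal{F}$ and any $U\in\mathcal{N}_G$ we have $UA_1\cap\cdots\cap UA_k\neq\emptyset$. A near ultrafilter is a maximal (with respect to inclusion) near filter. $S_G(X)$ is the set of near ultrafilters on $\mathrm{op}(X)$, with the topology generated by the basic open sets $N_A=\{p\in S_G(X): A\notin p\}$, $A\in\mathrm{op}(X)$. $G$ acts on $S_G(X)$ by: $A\in gp$ iff $g^{-1}A\in p$, for $A\in \mathrm{op}(X)$. With this topology and action $S_G(X)$ is a $G$-flow. *)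

(* Defs.v *)
From HB Require Import structures.
From mathcomp Require Import all_boot all_classical topology.

Set Implicit Arguments.
Unset Strict Implicit.
Unset Printing Implicit Defensive.

Local Open Scope classical_set_scope.

HB.mixin Record isTopologicalGroup G & Group G & Topological G := {
  mulg_continuous : continuous (fun z : G * G => (z.1 * z.2)%g);
  invg_continuous : continuous (fun g : G => g^-1%g)
}.

#[short(type="topologicalGroupType")]
HB.structure Definition TopologicalGroup :=
  {G of Group G & Topological G & isTopologicalGroup G}.

Section Flows.
Context {G : topologicalGroupType}.

Record is_flow (X : topologicalType) (act : G -> X -> X) : Prop := IsFlow {
  flow_compact : compact [set: X];
  flow_hausdorff : hausdorff_space X;
  flow_act1 : forall x, act 1%g x = x;
  flow_actM : forall g h x, act (g * h)%g x = act g (act h x);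
  flow_continuous : continuous (fun z : G * X => act z.1 z.2)
}.

Definition is_minimal_flow (X : topologicalType) (act : G -> X -> X) : Prop :=
  is_flow act /\ forall x, dense (range (act^~ x)).

End Flows.

Record flow (G : topologicalGroupType) := Flow {
  flow_space :> topologicalType;
  flow_act : G -> flow_space -> flow_space;
  flowP : is_flow flow_act
}.

Section NearUltrafilters.
Context {G : topologicalGroupType} (X : flow G).
Local Notation "g *> x" := (@flow_act G X g x) (at level 40, left associativity).

Definition sym_open_nbhs1 : set (set G) :=
  [set U | open U /\ U 1%g /\ (forall g, U g -> U g^-1%g)].

Definition op : set (set X) := [set A | open A /\ A !=set0].

Definition translate (g : G) (A : set X) : set X := [set g *> a | a in A].

Definition set_translate (U : set G) (A : set X) : set X :=
  [set g *> a | g in U & a in A].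

(* The finite families A_1, ..., A_k are taken with k >= 1. *)
Definition near_filter (F : set (set X)) : Prop :=
  F `<=` op /\
  forall (k : nat) (A : 'I_k.+1 -> set X) (U : set G),
    (forall i, F (A i)) -> sym_open_nbhs1 U ->
    \bigcap_(i in [set: 'I_k.+1]) set_translate U (A i) !=set0.

Definition near_ultrafilter (p : set (set X)) : Prop :=
  near_filter p /\ forall F, near_filter F -> p `<=` F -> F `<=` p.

Record SG := MkSG {
  SG_val : set (set X);
  SG_valP : near_ultrafilter SG_val
}.

HB.instance Definition _ := gen_eqMixin SG.
HB.instance Definition _ := gen_choiceMixin SG.

Definition SG_basic (A : set X) : set SG := [set p | ~ SG_val p A].

(* The sets N_A are used as a subbase: they need not cover S_G(X), e.g. when X *)
(* is a single point.                                                          *)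
HB.instance Definition _ := isSubBaseTopological.Build SG op SG_basic.

(* For p `<=` op, the set A ranges over op only, as translate g^-1 A is in op  *)
(* if and only if A is.                                                        *)
Definition translate_family (g : G) (p : set (set X)) : set (set X) :=
  [set A | p (translate g^-1%g A)].

Lemma flow_actK g : cancel (@flow_act G X g) (@flow_act G X g^-1%g).
Proof. by move=> x; rewrite -(flow_actM (flowP X)) mulVg (flow_act1 (flowP X)). Qed.

Lemma flow_actVK g : cancel (@flow_act G X g^-1%g) (@flow_act G X g).
Proof. by move=> x; rewrite -(flow_actM (flowP X)) mulgV (flow_act1 (flowP X)). Qed.

Lemma translateE g A : translate g A = [set x | A (g^-1%g *> x)].
Proof.
apply/seteqP; split=> x /=.
  by move=> [a Aa <-]; rewrite flow_actK.
by move=> Ax; exists (g^-1%g *> x) => //; rewrite flow_actVK.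
Qed.

Lemma translateK g : cancel (translate g) (translate g^-1%g).
Proof.
by move=> A; rewrite !translateE invgK; apply/seteqP; split=> x /=;
  rewrite flow_actK.
Qed.

Lemma translateVK g : cancel (translate g^-1%g) (translate g).
Proof. by move=> A; rewrite -{1}(invgK g) translateK. Qed.

Lemma op_translate g A : op A -> op (translate g A).
Proof.
move=> [oA [a Aa]]; split; last by exists (g *> a); exists a.
rewrite translateE; apply: (@open_comp _ _ (fun x : X => g^-1%g *> x)) => // x _.
apply: (@continuous_comp _ _ _ (fun x : X => (g^-1%g, x))
          (fun z : G * X => z.1 *> z.2)).
  by apply: cvg_pair => /=; [exact: cvg_cst | exact: cvg_id].
exact: (flow_continuous (flowP X)).
Qed.

Lemma sym_open_nbhs1_conj g (U : set G) :
  sym_open_nbhs1 U -> sym_open_nbhs1 [set h | U (g * (h * g^-1))%g].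
Proof.
move=> [oU [U1 UV]]; split; last split.
- apply: (@open_comp _ _ (fun h : G => g * (h * g^-1))%g) => // h _.
  apply: (@continuous_comp _ _ _ (fun h : G => (g, h * g^-1)%g)
            (fun z : G * G => z.1 * z.2)%g); last exact: mulg_continuous.
  apply: cvg_pair => /=; first exact: cvg_cst.
  apply: (@continuous_comp _ _ _ (fun h : G => (h, g^-1)%g)
            (fun z : G * G => z.1 * z.2)%g); last exact: mulg_continuous.
  by apply: cvg_pair => /=; [exact: cvg_id | exact: cvg_cst].
- by rewrite /= mul1g mulgV.
- move=> h /= /UV.
  by rewrite !invgM invgK mulgA.
Qed.

Lemma near_filter_translate g F : near_filter F -> near_filter (translate_family g F).
Proof.
move=> [Fop Fk]; split.
  by move=> A /Fop /(op_translate g); rewrite translateVK.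
move=> k A U FA symU.
have [x xP] := Fk k (fun i => translate g^-1%g (A i)) _ FA (sym_open_nbhs1_conj g symU).
exists (g *> x) => i _; have [h /= Uh [_ [a Aa <-]] <-] := xP i I.
exists (g * (h * g^-1))%g => //; exists a => //.
by rewrite !(flow_actM (flowP X)).
Qed.

Lemma near_ultrafilter_translate g p :
  near_ultrafilter p -> near_ultrafilter (translate_family g p).
Proof.
move=> [pF pmax]; split; first exact: near_filter_translate.
move=> F FF pleF A FA; rewrite /translate_family /=.
apply: (pmax _ (near_filter_translate g^-1%g FF)).
  by move=> B pB; apply: pleF; rewrite /translate_family /= invgK translateK.
by rewrite /translate_family /= invgK translateVK.
Qed.

Definition SG_act (g : G) (p : SG) : SG :=
  MkSG (near_ultrafilter_translate g (SG_valP p)).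

End NearUltrafilters.

(* Main.v *)
Require Import Defs.
From mathcomp Require Import all_boot all_classical topology.
From mathcomp Require Import finmap.

(**
The trace of a near filter F is the filter on X generated by the sets UA, for
A in F and U a symmetric open neighborhood of 1. If X is nonempty, being a near
filter means that the trace is proper, and maximality becomes a usable criterion ([SG_notin]): an
open nonempty A lies outside a near ultrafilter p exactly when some UA is
disjoint from a set of the trace of p. As V(VA) is contained in UA for V small,
A can moreover be fattened to VA without entering p ([SG_notin_fatten]). These
facts also make p upward closed, and prime: if the union of two open sets is
dense, then one of them is in p ([SG_dense_cover]).

Compactness. Given an ultrafilter on S_G(X), the sets A that belong to almost
every q form a near filter. Extend it to a near ultrafilter p by Zorn's lemma;
if A is not in p, then A is missing from almost every q, so p is a limit.

Hausdorff property. If A is in p but not in q, fatten A to C = VA outside q, and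
let D be the complement of the closure of C. As VA and D are disjoint, D is not
in p. But the union of C and D is dense, so no r avoids both, and N_D, N_C
separate p from q.

Continuity. If A is not in gp, fatten g^-1 A to D = W(g^-1 A) outside p. When h
is so close to g that h^-1 g is in W, the set h^-1 A is contained in D, hence
hq avoids A for all q in N_D.

Minimality. Let X be nonempty, the other case being trivial. Two facts link X
and S_G(X). By compactness of X the trace of p has a cluster point x, and every open set containing x is then in p
([SG_contains_point_nbhs]). Conversely, every neighborhood N of a point of
S_G(X) contains all the r that have a certain open nonempty O as a member
([SG_nbhs_member]). If the orbit of x is dense, some gx lies in O; then g^-1 O
is in p, so O is in gp, and gp is in N. *)

Local Open Scope classical_set_scope.

(** * Symmetric open neighborhoods of the identity *)

Section SymmetricNeighborhoods.
Context {G : topologicalGroupType}.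
Implicit Types U V W : set G.

Lemma sym_open_nbhs1_nbhs {U} : sym_open_nbhs1 U -> nbhs 1%g U.
Proof. by move=> [oU [U1 _]]; exact: open_nbhs_nbhs. Qed.

Lemma sym_open_nbhs1_sqrt {U} : nbhs 1%g U -> exists2 V,
  sym_open_nbhs1 V & forall g h, V g -> V h -> U (g * h)%g.
Proof.
move=> nU.
have : nbhs ((1, 1)%g : G * G) ((fun z : G * G => z.1 * z.2)%g @^-1` U).
  by apply: mulg_continuous => /=; rewrite mulg1.
move=> -[[P Q] /= [nP nQ] PQ].
set O := (P `&` Q)°.
have oO : open O by exact: open_interior.
have OP g : O g -> P g by move=> /interior_subset[].
have OQ g : O g -> Q g by move=> /interior_subset[].
exists (O `&` [set g | O g^-1%g]).
  split; last split.
  - apply: openI => //.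
    by apply: open_comp => // g _; exact: invg_continuous.
  - by split; rewrite /= ?invg1; apply: filterI.
  - by move=> g [Og OVg]; split=> //=; rewrite invgK.
by move=> g h [/OP Pg _] [/OQ Qh _]; exact: (PQ (g, h)).
Qed.

End SymmetricNeighborhoods.

(** * Thickenings UA of subsets of a flow *)

Section NearUltrafilterFlow.
Context {G : topologicalGroupType} (X : flow G).
Implicit Types (U V W : set G) (A B S : set X) (F : set (set X)) (p q r : SG X).
Local Notation "g *> x" := (@flow_act G X g x) (at level 40, left associativity).

Lemma open_translate g A : open A -> open (translate g A).
Proof.
move=> oA; have [->|/set0P A0] := eqVneq A set0.
  by rewrite /translate image_set0; exact: open0.
by have [] := op_translate g (conj oA A0).
Qed.

Lemma open_set_translate U A : open A -> open (set_translate U A).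
Proof.
move=> oA.
suff -> : set_translate U A = \bigcup_(g in U) translate g A.
  by apply: bigcup_open => g _; exact: open_translate.
apply/seteqP; split=> x.
  by move=> [g Ug [a Aa <-]]; exists g => //; exists a.
by move=> [g Ug [a Aa <-]]; exists g => //; exists a.
Qed.

Lemma sub_set_translate {U A} : sym_open_nbhs1 U -> A `<=` set_translate U A.
Proof.
by move=> [_ [U1 _]] a Aa; exists 1%g => //; exists a => //;
  rewrite (flow_act1 (flowP X)).
Qed.

Lemma set_translateS U V A B : U `<=` V -> A `<=` B ->
  set_translate U A `<=` set_translate V B.
Proof.
move=> UV AB x [g Ug [a Aa <-]].
by exists g; [exact: UV|exists a => //; exact: AB].
Qed.

Lemma op_set_translate {U A} : sym_open_nbhs1 U -> op A ->
  op (set_translate U A).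
Proof.
move=> sU [oA [a Aa]]; split; first exact: open_set_translate.
by exists a; exact: sub_set_translate Aa.
Qed.

(** If va = wb with v, w in V, then b = (w^-1 v)a, and w^-1 v is in U because V
    is symmetric. *)
Lemma meets_set_translate {U V A B} : sym_open_nbhs1 V ->
  (forall g h, V g -> V h -> U (g * h)%g) ->
  set_translate V A `&` set_translate V B !=set0 ->
  set_translate U A `&` B !=set0.
Proof.
move=> [_ [_ Vinv]] VU [_ [[g Vg [a Aa <-]] [h Vh [b Bb hbga]]]].
exists b; split=> //; exists (h^-1 * g)%g; first by apply: VU => //; exact: Vinv.
by exists a => //; rewrite (flow_actM (flowP X)) -hbga flow_actK.
Qed.

(** * The trace filter of a near filter *)

Definition near_trace F : set_system X := smallest Filter
  [set set_translate z.1 z.2 | z in @sym_open_nbhs1 G `*` F].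

Global Instance near_trace_filter F : Filter (near_trace F).
Proof. exact: smallest_filter_filter. Qed.

Lemma near_traceT F : near_trace F [set: X].
Proof. exact: filterT. Qed.

Lemma near_traceI F A B :
  near_trace F A -> near_trace F B -> near_trace F (A `&` B).
Proof. exact: (@filterI _ (near_trace F)). Qed.

Lemma near_traceS F A B : A `<=` B -> near_trace F A -> near_trace F B.
Proof. exact: (@filterS _ (near_trace F)). Qed.

Lemma near_trace_set_translate {F U A} : sym_open_nbhs1 U -> F A ->
  near_trace F (set_translate U A).
Proof. by move=> sU FA; apply: sub_gen_smallest; exists (U, A). Qed.

(** The definition of a near filter thickens all sets by one U, while the
    generators of the trace have unrelated ones: a finite meet of generators is
    bounded below by thickening by a W inside all the U involved. A point of X
    is needed for the meet of the empty family. *)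
Lemma near_trace_proper {F} : [set: X] !=set0 -> near_filter F ->
  ProperFilter (near_trace F).
Proof.
move=> [x0 _] [_ FF]; rewrite /near_trace -smallest_filter_finI.
apply: finI_filter => D' D'F.
have : nbhs 1%g (\bigcap_(z in [set` D']) z.1).
  apply: filter_bigI => z /D'F/set_mem[/= sz _].
  exact: sym_open_nbhs1_nbhs.
move=> /sym_open_nbhs1_sqrt[W sW WD'].
have [s sD'] : exists s : seq (set G * set X), forall z, (z \in D') = (z \in s).
  by exists (enum_fset D').
(* A near filter is tested on nonempty families, hence the case split. *)
case: s sD' => [|z0 s] sD'.
  by exists x0 => z; rewrite /= sD'.
pose A (i : 'I_(size s).+1) := (nth z0 (z0 :: s) i).2.
have FA i : F (A i).
  have /D'F/set_mem[] // : nth z0 (z0 :: s) i \in D'.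
  by rewrite sD' mem_nth /=.
have [x xA] := FF _ A W FA sW.
exists x => z zD'; have zs : z \in z0 :: s by rewrite -sD'.
have ilt : (index z (z0 :: s) < (size s).+1)%N.
  by rewrite -[(size s).+1]/(size (z0 :: s)) index_mem.
have := xA (Ordinal ilt) I; rewrite /A [nat_of_ord _]/= nth_index //.
apply: set_translateS => // g Wg; have [_ [W1 _]] := sW.
by have := WD' _ _ Wg W1; rewrite mulg1 => /(_ z); apply.
Qed.

(** The generators UA are open, and interiors commute with finite meets. *)
Lemma near_trace_interior {F S} : F `<=` @op G X -> near_trace F S ->
  near_trace F (S°).
Proof.
move=> Fop; apply: (@smallest_sub _ _ _ [set S | near_trace F S°]).
  apply: Build_Filter => /=.
  - by rewrite interiorT; exact: near_traceT.
  - by move=> P Q FP FQ; rewrite /mkset interiorI; exact: near_traceI.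
  - by move=> P Q PQ; apply: near_traceS; exact: interiorS.
move=> _ [[U A] [/= sU FA] <-].
have oUA : open (set_translate U A).
  by apply: open_set_translate; have [] := Fop _ FA.
by rewrite /= (proj1 (interior_id _)) //; exact: near_trace_set_translate.
Qed.

(** * Membership in a near ultrafilter *)

Lemma SG_near_filter p : near_filter (SG_val p).
Proof. by have [] := SG_valP p. Qed.

Lemma SG_op {p A} : SG_val p A -> op A.
Proof. by have [/(_ A)] := SG_near_filter p. Qed.

(** The inclusion is an equality because p is maximal. *)
Lemma SG_inj p q : SG_val p `<=` SG_val q -> p = q.
Proof.
move=> pq; have [_ pmax] := SG_valP p.
have := pmax _ (SG_near_filter q) pq.
case: p q pq {pmax} => [p pP] [q qP] /= pq qp.
have e : p = q by apply/seteqP.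
by move: pP; rewrite e => pP; rewrite (Prop_irrelevance pP qP).
Qed.

Lemma SG_trace_proper {p A} : SG_val p A -> ProperFilter (near_trace (SG_val p)).
Proof.
move=> /SG_op[_ [a _]]; apply: near_trace_proper (SG_near_filter p).
by exists a.
Qed.

(** The working form of maximality: if no UA misses a set of the trace, then
    adding A to p gives a near filter. *)
Lemma SG_notin {p A} : op A -> ~ SG_val p A -> exists2 U, sym_open_nbhs1 U &
  near_trace (SG_val p) (~` set_translate U A).
Proof.
move=> opA; apply: contra_notP => noU.
have [_ pmax] := SG_valP p.
apply: (pmax (SG_val p `|` [set A])) => //; last by right.
split=> [B [/SG_op//|-> //]|k B U pB sU]; apply: contrapT => empty; apply: noU.
exists U => //.
have /filter_forall : forall i, \forall x \near near_trace (SG_val p),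
    SG_val p (B i) -> set_translate U (B i) x.
  move=> i; have [pBi|npBi] := pselect (SG_val p (B i)); last first.
    by apply: nearW => x /npBi.
  by have := near_trace_set_translate sU pBi; apply: near_traceS => x xB _.
apply: near_traceS => x xB UAx; apply: empty; exists x => i _.
by have [/xB//|->] := pB i.
Qed.

Lemma SG_mem p A : op A ->
  (forall U S, sym_open_nbhs1 U -> near_trace (SG_val p) S ->
     set_translate U A `&` S !=set0) -> SG_val p A.
Proof.
move=> opA meet; apply: contrapT => /(SG_notin opA)[U sU /(meet _ _ sU)].
by case=> x [].
Qed.

Lemma SG_meets {p A U S} : SG_val p A -> sym_open_nbhs1 U ->
  near_trace (SG_val p) S -> set_translate U A `&` S !=set0.
Proof.
move=> pA sU pS; have pf := SG_trace_proper pA.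
apply: (@filter_ex _ _ pf); apply: near_traceI => //.
exact: near_trace_set_translate.
Qed.

(** Fattening A by V with VV inside U leaves V(VA) inside UA, which a set of the
    trace of p avoids. *)
Lemma SG_notin_fatten {p A} : op A -> ~ SG_val p A ->
  exists2 V, sym_open_nbhs1 V & ~ SG_val p (set_translate V A).
Proof.
move=> opA npA; have [U sU pU] := SG_notin opA npA.
have [V sV VU] := sym_open_nbhs1_sqrt (sym_open_nbhs1_nbhs sU).
exists V => // pVA.
have [x [[g Vg [_ [h Vh [a Aa <-]] <-]]]] := SG_meets pVA sV pU.
apply; exists (g * h)%g; first exact: VU.
by exists a => //; rewrite (flow_actM (flowP X)).
Qed.

Lemma SG_sup {p A B} : SG_val p A -> A `<=` B -> open B -> SG_val p B.
Proof.
move=> pA AB oB; have [_ [a Aa]] := SG_op pA.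
apply: SG_mem => [|U S sU pS]; first by split=> //; exists a; exact: AB.
have [x [UAx Sx]] := SG_meets pA sU pS.
by exists x; split=> //; exact: set_translateS UAx.
Qed.

(** If A and B were both missing, their complements, and so the interior of the
    complement of the union, would be in the trace, which is proper. *)
Lemma SG_dense_cover p A B : [set: X] !=set0 -> open A -> open B ->
  dense (A `|` B) -> SG_val p A \/ SG_val p B.
Proof.
move=> X0 oA oB dAB; apply: contrapT => /not_orP[npA npB].
have avoid C : open C -> ~ SG_val p C -> near_trace (SG_val p) (~` C).
  move=> oC npC; have [->|/set0P C0] := eqVneq C set0.
    by rewrite setC0; exact: near_traceT.
  have [U sU] := SG_notin (conj oC C0) npC; apply: near_traceS.
  by apply: subsetC; exact: sub_set_translate.
have pf := near_trace_proper X0 (SG_near_filter p).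
have : near_trace (SG_val p) (~` A `&` ~` B).
  by apply: near_traceI; exact: avoid.
move=> /(near_trace_interior (proj1 (SG_near_filter p))) pAB.
have [x [/interior_subset[nA nB] [//|//]]] :=
  dAB _ (filter_ex pAB) (@open_interior _ _).
Qed.

(** * Extending near filters to near ultrafilters *)

Lemma near_filter_chain_union F (C : set (set (set X))) : near_filter F ->
  (forall B : set (set X), C B -> near_filter (F `|` B)) -> total_on C subset ->
  near_filter (F `|` \bigcup_(B in C) (B : set (set X))).
Proof.
move=> FF Cnear Ctot; split.
  move=> A [FA|[B CB BA]]; first exact: (proj1 FF).
  by apply: (proj1 (Cnear _ CB)); right.
move=> k A U FCA sU.
suff [B nB BA] : exists2 B : set (set X), near_filter (F `|` B) &
    forall i, (F `|` B) (A i).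
  exact: (proj2 nB).
suff [B CB BA] : exists2 B : set (set X), B = set0 \/ C B &
    forall i, (F `|` B) (A i).
  exists B => //; case: CB => [->|/Cnear//].
  by rewrite setU0.
(* Finitely many sets from the union of a chain come from one member of it; the
   value set0 stands for the case that all of them are in F. *)
have {U sU} : forall s : seq 'I_k.+1, exists2 B : set (set X), B = set0 \/ C B &
    forall i, i \in s -> (F `|` B) (A i).
  elim=> [|i s [B CB Bs]]; first by exists set0 => //; left.
  have [FAi|[D CD DAi]] := FCA i.
    by exists B => // j; rewrite inE => /predU1P[->|/Bs//]; left.
  have [DB|BD] : D `<=` B \/ B `<=` D.
    case: CB => [->|CB]; first by right.
    exact: Ctot.
  - exists B => // j; rewrite inE => /predU1P[->|/Bs//].
    by right; exact: DB.
  - exists D; first by right.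
    move=> j; rewrite inE => /predU1P[->|/Bs]; first by right.
    by case=> [|/BD]; [left|right].
move=> /(_ (enum 'I_k.+1))[B CB BA]; exists B => // i.
by apply: BA; rewrite mem_enum.
Qed.

(** Zorn's lemma is applied to the families B whose union with F is a near
    filter, rather than to near filters containing F, so that the union of the
    empty chain qualifies. *)
Lemma near_ultrafilter_extension {F} : near_filter F ->
  exists p, F `<=` SG_val p.
Proof.
move=> FF.
have [|B [nFB Bmax]] := @Zorn_bigcup _ [set B | near_filter (F `|` B)].
  by move=> C Cnear Ctot; exact: near_filter_chain_union.
have uFB : near_ultrafilter (F `|` B).
  split=> // F' nF' FBF' A F'A; apply: contrapT => nFBA.
  have FF' : F `|` F' = F' by apply/setUidPr => C FC; apply: FBF'; left.
  apply: (Bmax F'); last by rewrite /= FF'.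
  split=> [C BC|F'B]; first by apply: FBF'; right.
  by apply: nFBA; right; exact: F'B.
by exists (MkSG uFB) => A FA; left.
Qed.

(** * The space of near ultrafilters is a flow *)

Lemma open_SG_basic A : op A -> open (SG_basic A : set (SG X)).
Proof.
move=> opA; exists [set SG_basic A]; last by rewrite bigcup_set1.
by move=> _ ->; apply: finI_from1.
Qed.

(** Convergence may be tested on the subbase. It is stated for an arbitrary
    filter P because P will be an ultrafilter for compactness, an image filter
    for continuity, and an ad hoc filter in [SG_nbhs_member]. *)
Lemma SG_cvg (P : set_system (SG X)) p : Filter P ->
  (forall A, op A -> ~ SG_val p A -> P (SG_basic A)) -> P --> p.
Proof.
move=> PF Pp O; rewrite nbhsE /= => -[O' [[C Cop <-] [Q CQ Qp]] sO].
apply: filterS sO _; apply: (@filterS _ _ _ Q); first by move=> r Qr; exists Q.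
have [D' D'op QE] := Cop _ CQ; rewrite -QE; apply: filter_bigI => A AD'.
apply: Pp; first exact/set_mem/D'op.
by move: Qp; rewrite -QE => /(_ A AD').
Qed.

Lemma SG_compact : compact [set: SG X].
Proof.
rewrite compact_ultra => P UP _.
pose F := [set A : set X | P [set q | SG_val q A]].
have nF : near_filter F.
  split=> [A PA|k A U FA sU].
    by have [q qA] := @filter_ex _ P _ _ PA; exact: SG_op qA.
  have [q qA] := @filter_ex _ P _ _ (@filter_forall _ _ _ P _ FA).
  exact: (proj2 (SG_near_filter q)).
have [p Fp] := near_ultrafilter_extension nF.
exists p; split=> //; apply: SG_cvg => A opA npA.
have [PA|//] := @in_ultra_setVsetC _ P [set q | SG_val q A] UP.
by exfalso; apply: npA; exact: Fp.
Qed.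

Lemma SG_hausdorff : hausdorff_space (SG X).
Proof.
move=> p q pq; apply: contrapT => pNq.
have [A [pA nqA]] : exists A, SG_val p A /\ ~ SG_val q A.
  apply: contrapT => /forallNP nA; apply: pNq; apply: SG_inj => A pA.
  by apply: contrapT => nqA; apply: (nA A).
have opA := SG_op pA.
have X0 : [set: X] !=set0 by have [_ [a _]] := opA; exists a.
have [V sV nqC] := SG_notin_fatten opA nqA.
have [W sW WV] := sym_open_nbhs1_sqrt (sym_open_nbhs1_nbhs sV).
set C := set_translate V A in nqC *; set D := ~` closure C.
have opC : op C by exact: op_set_translate.
have oD : open D by apply: closed_openC; exact: closed_closure.
have npD : ~ SG_val p D.
  move=> pD; have := SG_meets pA sW (near_trace_set_translate sW pD).
  move=> /(meets_set_translate sW WV)[x [Cx]].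
  by apply; exact: subset_closure.
(* D may be empty; it then lies in no near ultrafilter at all. *)
have nD : nbhs p (SG_basic D).
  have [opD|nopD] := pselect (op D).
    by apply: open_nbhs_nbhs; split; first exact: open_SG_basic.
  by apply: filterS filterT => r _ /SG_op.
have nC : nbhs q (SG_basic C).
  by apply: open_nbhs_nbhs; split; first exact: open_SG_basic.
have [r [nrD nrC]] := pq _ _ nD nC.
have dCD : dense (C `|` D).
  move=> O [x Ox] oO; have [clCx|nclCx] := pselect (closure C x).
    have [|y [Cy Oy]] := clCx O; first exact: open_nbhs_nbhs.
    by exists y; split=> //; left.
  by exists x; split=> //; right.
by have [] := SG_dense_cover r _ _ X0 (proj1 opC) oD dCD.
Qed.

Lemma SG_act_continuous :
  continuous (fun z : G * SG X => @SG_act G X z.1 z.2).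
Proof.
move=> [g p]; apply: SG_cvg => A opA /= npA.
have [W sW npD] := SG_notin_fatten (op_translate g^-1%g opA) npA.
set D := set_translate W (translate g^-1%g A) in npD *.
have opD : op D by apply: op_set_translate => //; exact: op_translate.
exists ([set h | W (h^-1 * g)%g], SG_basic D); first split => /=.
- apply: open_nbhs_nbhs; split; last first.
    by rewrite /= mulVg; have [_ []] := sW.
  have [oW _] := sW; apply: (@open_comp _ _ (fun h : G => h^-1 * g)%g) => // h _.
  apply: (@continuous_comp _ _ _ (fun h : G => (h^-1, g)%g)
            (fun z : G * G => z.1 * z.2)%g); last exact: mulg_continuous.
  by apply: cvg_pair => /=; [exact: invg_continuous|exact: cvg_cst].
- by apply: open_nbhs_nbhs; split; first exact: open_SG_basic.
(* The set h^-1 A = (h^-1 g)(g^-1 A) is contained in D. *)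
move=> [h q] [/= Wh nqD] qA; apply: nqD.
apply: (@SG_sup _ (translate h^-1%g A) _ qA); last first.
  by have [] := opD.
move=> _ [a Aa <-]; exists (h^-1 * g)%g => //.
exists (g^-1%g *> a); first by exists a.
by rewrite -(flow_actM (flowP X)) mulgK.
Qed.

Lemma SG_is_flow : is_flow (@SG_act G X).
Proof.
split.
- exact: SG_compact.
- exact: SG_hausdorff.
- move=> p; apply: SG_inj => A; rewrite /= /translate_family /= translateE.
  suff -> : [set x | A (1^-1^-1%g *> x)] = A by [].
  by apply/seteqP; split=> x /=; rewrite !invg1 (flow_act1 (flowP X)).
- move=> g h p; apply: SG_inj => A; rewrite /= /translate_family /= !translateE.
  suff -> : [set x | A ((g * h)^-1^-1%g *> x)] =
            [set x | A (g^-1^-1%g *> (h^-1^-1%g *> x))] by [].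
  by apply/seteqP; split=> x /=; rewrite !invgK (flow_actM (flowP X)).
- exact: SG_act_continuous.
Qed.

(** * Minimality *)

(** The point is a cluster point of the trace of p, provided by the compactness
    of X. *)
Lemma SG_contains_point_nbhs p : [set: X] !=set0 ->
  exists x, forall O, open O -> O x -> SG_val p O.
Proof.
move=> X0; have pf := near_trace_proper X0 (SG_near_filter p).
have [x [_ clx]] := flow_compact (flowP X) pf (near_traceT _).
exists x => O oO Ox; apply: SG_mem => [|U S sU pS]; first by split=> //; exists x.
have [y [Sy Oy]] : S `&` O !=set0.
  by apply: clx => //; exact: open_nbhs_nbhs.
by exists y; split=> //; exact: sub_set_translate Oy.
Qed.

(** The set O is taken in the trace of q, which is proper, so that O stays
    nonempty when finitely many conditions on r are combined. The filter P of the
    sets that contain {r : O in r} for some such O contains N_A for A not in q,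
    since the trace of q has a set disjoint from some UA, and no r has both the
    interior of that set and A as members. *)
Lemma SG_nbhs_member q (N : set (SG X)) : [set: X] !=set0 -> nbhs q N ->
  exists2 O, op O & forall r, SG_val r O -> N r.
Proof.
move=> X0 qN.
have pf := near_trace_proper X0 (SG_near_filter q).
pose P : set_system (SG X) := [set M | exists2 O, open O /\
  near_trace (SG_val q) O & forall r, SG_val r O -> M r].
have PF : Filter P.
  apply: Build_Filter.
  - by exists [set: X] => //; split; [exact: openT|exact: near_traceT].
  - move=> M M' [O [oO qO] OM] [O' [oO' qO'] OM'].
    exists (O `&` O'); first by split; [exact: openI|exact: near_traceI].
    by move=> r rOO'; split; [apply: OM|apply: OM'];
      apply: SG_sup rOO' _ _ => // x [].
  - by move=> M M' MM' [O qO OM]; exists O => // r /OM /MM'.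
have Pq : P --> q.
  apply: SG_cvg => A opA nqA; have [U sU qU] := SG_notin opA nqA.
  have [W sW WU] := sym_open_nbhs1_sqrt (sym_open_nbhs1_nbhs sU).
  exists (~` set_translate U A)°.
    split; first exact: open_interior.
    exact: near_trace_interior (proj1 (SG_near_filter q)) qU.
  move=> r rO rA; have := SG_meets rA sW (near_trace_set_translate sW rO).
  by move=> /(meets_set_translate sW WU)[x [UAx /interior_subset]].
have [O [oO qO] ON] := Pq _ qN.
by exists O => //; split=> //; exact: (@filter_ex _ _ pf).
Qed.

Lemma SG_orbit_dense p : is_minimal_flow (@flow_act G X) ->
  dense (range ((@SG_act G X)^~ p)).
Proof.
move=> [_ Xmin] N [q Nq] oN.
(* If X is empty, then the empty family is the only near ultrafilter. *)
have [X0|nX0] := pselect ([set: X] !=set0); last first.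
  exists q; split=> //; exists 1%g => //; apply: SG_inj => A.
  by move=> /SG_op[_ [a _]]; exfalso; apply: nX0; exists a.
have [O [oO O0] ON] := SG_nbhs_member q N X0 (open_nbhs_nbhs (conj oN Nq)).
have [x px] := SG_contains_point_nbhs p X0.
have [y [Oy [g _ gx]]] := Xmin x O O0 oO.
exists (SG_act g p); split; last by exists g.
apply: ON; apply: px; first exact: open_translate.
by exists y => //; rewrite -gx; exact: flow_actK.
Qed.

End NearUltrafilterFlow.

Theorem proposition2p7 (G : topologicalGroupType) (hG : hausdorff_space G)
    (X : flow G) :
  is_minimal_flow (@flow_act G X) -> is_minimal_flow (@SG_act G X).
Proof.
move=> Xmin; split; first exact: SG_is_flow.
by move=> p; exact: SG_orbit_dense.
Qed.
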